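(* Let $\{P_k\}_{k\ge1}$ be binary matrices, $P_k$ of size $m_k\times n_k$ with $m_k,n_k\to\infty$, converging to an asymmetric graphon $W$ (i.e. $\delta_\Box(P_k,W)\to0$) which is nonzero almost everywhere. Let $\{A_k\},\{B_k\}$ be sequences of real $m_k\times n_k$ matrices, and suppose there are numbers $q,L$ with $\|A_k\|_*,\|B_k\|_*\le q\sqrt{m_kn_k}$ and $\|A_k\|_\infty,\|B_k\|_\infty\le L$ for all $k$. Then for every $\varepsilon>0$ there is $\delta>0$, depending only on $\varepsilon,q,L$, such that if $\limsup_{k\to\infty}\|(A_k-B_k)\circ P_k\|_{\bar F}\le\delta$ then $\limsup_{k\to\infty}\|A_k-B_k\|_{\bar F}\le\varepsilon$.
   Context: A binary matrix has entries in $\{0,1\}$. For an $m\times n$ real matrix $A$: $\|A\|_\infty=\max|a_{ij}|$; $\|A\|_*$ is the sum of singular values; $\|A\|_{\bar F}=\big(\frac1{mn}\sum_{i,j}a_{ij}^2\big)^{1/2}$; $\|A\|_\Box=\frac1{mn}\max\{|x^TAy|:x\in\mathbb{R}^m,y\in\mathbb{R}^n,\|x\|_\infty\le1,\|y\|_\infty\le1\}$; $\circ$ is the entrywise product. $A^{\pi,\tau}$ has $(i,j)$ entry $a_{\pi(i)\tau(j)}$ for permutations $\pi,\tau$ of rows and columns, and $\delta_\Box(A,B)=\min_{\pi,\tau}\|A^{\pi,\tau}-B\|_\Box$. An asymmetric graphon is a Borel measurable $W:[0,1]^2\to[0,1]$; $W_{m,n}$ is the $m\times n$ matrix with $(i,j)$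 entry $mn\int_{(i-1)/m}^{i/m}\int_{(j-1)/n}^{j/n}W(x,y)\,dy\,dx$, and $\delta_\Box(A,W):=\delta_\Box(A,W_{m,n})$.
   Formalization: The number δ may depend on the graphon W and the sequence P_k as well as on ε, q, L (but not on A_k, B_k); independence of W fails, e.g. for constant graphons W = η with η → 0. *)

(* Defs.v *)
From HB Require Import structures.
From mathcomp Require Import all_boot all_order all_algebra all_fingroup.
From mathcomp Require Import all_classical all_reals all_analysis.
Set Implicit Arguments. Unset Strict Implicit. Unset Printing Implicit Defensive.
Import Order.TTheory GRing.Theory Num.Theory.
Import numFieldNormedType.Exports.
Local Open Scope classical_set_scope.
Local Open Scope ring_scope.

Section Defs.
Variable R : realType.

Definition binary_mx m n (P : 'M[R]_(m, n)) : Prop :=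
  forall i j, P i j = 0 \/ P i j = 1.

Definition maxnorm m n (A : 'M[R]_(m, n)) : R := \big[Num.max/0]_(i < m) \big[Num.max/0]_(j < n) `|A i j|.

(* s is the list of singular values of A (padded with zeros to length n):
   the sigma's are >= 0 and their squares are the eigenvalues of A^T A
   with multiplicity, i.e. char_poly (A^T A) = prod (X - sigma^2). *)
Definition is_singular_values m n (A : 'M[R]_(m, n)) (s : seq R) : Prop :=
  all (fun x => 0 <= x) s /\
  char_poly (A^T *m A) = \prod_(x <- s) ('X - (x ^+ 2)%:P).

Definition nucnorm m n (A : 'M[R]_(m, n)) : R :=
  match pselect (exists s, is_singular_values A s) with
  | left h => \sum_(x <- proj1_sig (cid h)) x
  | right _ => 0
  end.

Definition frobn m n (A : 'M[R]_(m, n)) : R :=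
  Num.sqrt ((m * n)%:R^-1 * \sum_(i < m) \sum_(j < n) A i j ^+ 2).

Definition hadamard m n (A B : 'M[R]_(m, n)) : 'M[R]_(m, n) :=
  \matrix_(i, j) (A i j * B i j).

Definition cutnorm m n (A : 'M[R]_(m, n)) : R :=
  (m * n)%:R^-1 *
  sup [set r : R | exists (x : 'cV[R]_m) (y : 'cV[R]_n),
         (forall i, `|x i 0| <= 1) /\ (forall j, `|y j 0| <= 1) /\
         r = `|(x^T *m A *m y) 0 0|].

Definition permute_mx m n (A : 'M[R]_(m, n)) (pi : {perm 'I_m}) (tau : {perm 'I_n}) :=
  \matrix_(i, j) A (pi i) (tau j).

Definition cutdist m n (A B : 'M[R]_(m, n)) : R :=
  inf [set r : R | exists (pi : {perm 'I_m}) (tau : {perm 'I_n}),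
         r = cutnorm (permute_mx A pi tau - B)].

Definition unit_sq : set (R * R) := [set z | z.1 \in `[0, 1] /\ z.2 \in `[0, 1]].

Definition graphon (W : R * R -> R) : Prop :=
  measurable_fun unit_sq W /\ (forall z, unit_sq z -> 0 <= W z <= 1).

Definition leb2 := ((@lebesgue_measure R) \x (@lebesgue_measure R))%E.

Definition graphon_mx (W : R * R -> R) m n : 'M[R]_(m, n) :=
  \matrix_(i < m, j < n)
    ((m * n)%:R * Rintegral leb2
       ([set z : R * R | z.1 \in `[i%:R / m%:R, i.+1%:R / m%:R] /\
                        z.2 \in `[j%:R / n%:R, j.+1%:R / n%:R]]) W).

Definition nonzero_ae (W : R * R -> R) : Prop :=
  leb2 [set z | unit_sq z /\ W z = 0] = 0%E.

End Defs.

(* Main.v *)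
(** Write [D = A - B]. The right singular vectors [v] of a matrix with entries
    bounded by [L] and singular value above [t sqrt(mn)] have entries of order
    [1/sqrt n], since [v = A^T A v / sigma^2]. A nuclear norm at most
    [q sqrt(mn)] allows at most [q/t] such singular values, and the others have
    squares summing to at most [q t mn]. So, up to a small Frobenius error, [D] is
    a sum of boundedly many rank-one matrices [x y^T] with bounded [x] and [y],
    and so is its entrywise square. The cut norm controls the pairing with such
    matrices, hence the means of [D^2 P] and of [D^2 W_(m,n)] are close, and the
    latter is small. As [W > 0] almost everywhere, the set [{W < k}] has small
    measure for small [k], and Markov's inequality on each grid cell bounds the
    mean of [D^2] by [k^-1] times the mean of [D^2 W_(m,n)] plus
    [4 L^2 |{W < k}|]. *)

Require Import Defs.
From HB Require Import structures.
From mathcomp Require Import all_boot all_order all_algebra all_fingroup.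
From mathcomp Require Import all_classical all_reals all_analysis.
From mathcomp Require Import measurable_realfun complex ring lra.
Import Order.TTheory GRing.Theory Num.Theory.
Import numFieldNormedType.Exports.
Set Implicit Arguments.
Unset Strict Implicit.
Unset Printing Implicit Defensive.
Local Open Scope classical_set_scope.
Local Open Scope ring_scope.

(** * Singular values and truncation *)

(** Over the algebraically closed field [R[i]] the matrix has an eigenvector [p + iq] with
    eigenvalue [a + ib]; the two equations are its real and imaginary parts. *)
Lemma real_eigenpair (R : rcfType) n (X : 'M[R]_n) : (0 < n)%N ->
  exists (p q : 'rV[R]_n) (a b : R), [/\ (p != 0) || (q != 0),
    p *m X = a *: p - b *: q & q *m X = a *: q + b *: p].
Proof.
move=> n0.
have [a /eigenvalueP[v vX v0]] := eigenvalue_closed (map_mx (real_complex R) X) n0.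
exists (map_mx (@complex.Re R) v), (map_mx (@complex.Im R) v), (complex.Re a), (complex.Im a).
have E i : \sum_j (v 0 j * (X j i)%:C)%C = a * v 0 i.
  by move/matrixP: vX => /(_ 0 i); rewrite !mxE => <-; apply: eq_bigr => j _; rewrite mxE.
split.
- apply: contra_neqT v0; rewrite negb_or !negbK => /andP[/eqP p0 /eqP q0].
  apply/rowP => i; rewrite mxE; apply/eqP; rewrite eq_complex.
  by move/rowP: p0 => /(_ i); move/rowP: q0 => /(_ i); rewrite !mxE => -> ->; rewrite eqxx.
- apply/rowP => i; rewrite !mxE.
  have := congr1 (@complex.Re R) (E i).
  rewrite raddf_sum; case: a {vX E} => a1 a2; case: (v 0 i) => v1 v2 /= <-.
  by apply: eq_bigr => j _; rewrite !mxE; case: (v 0 j) => x y /=; rewrite mulr0 subr0.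
- apply/rowP => i; rewrite !mxE.
  have := congr1 (@complex.Im R) (E i).
  rewrite raddf_sum; case: a {vX E} => a1 a2; case: (v 0 i) => v1 v2 /= <-.
  by apply: eq_bigr => j _; rewrite !mxE; case: (v 0 j) => x y /=; rewrite mulr0 add0r.
Qed.

Lemma row_dotC (R : comPzRingType) n (x y : 'rV[R]_n) :
  (x *m y^T) 0 0 = (y *m x^T) 0 0.
Proof. by rewrite !mxE; apply: eq_bigr => i _; rewrite !mxE mulrC. Qed.

Lemma row_dot_ge0 (R : realDomainType) n (x : 'rV[R]_n) : 0 <= (x *m x^T) 0 0.
Proof. by rewrite mxE sumr_ge0 // => i _; rewrite mxE -expr2 sqr_ge0. Qed.

Lemma row_dot_eq0 (R : realDomainType) n (x : 'rV[R]_n) :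
  ((x *m x^T) 0 0 == 0) = (x == 0).
Proof.
apply/eqP/eqP => [|->]; last by rewrite mul0mx mxE.
rewrite mxE => /eqP; rewrite psumr_eq0 => [/allP H|i _]; last by rewrite mxE -expr2 sqr_ge0.
apply/rowP => i; have := H i (mem_index_enum i).
by rewrite !mxE /= mulf_eq0 orbb => /eqP.
Qed.

(* Writing a complex eigenvector as p + iq, symmetry forces b (|p|^2 + |q|^2) = 0. *)
Lemma symmetric_stable_eigenvector (R : rcfType) n k (S : 'M[R]_n) (W : 'M[R]_(k, n)) :
  S^T = S -> (0 < k)%N -> row_free W -> (W *m S <= W)%MS ->
  exists (w : 'rV[R]_n) (a : R), [/\ w != 0, (w <= W)%MS & w *m S = a *: w].
Proof.
move=> sS k0 Wf /submxP[X WS].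
(* [X] is the matrix of [S] on the row space of [W]. Multiplying by [W] carries the eigenpair back,
   and freeness of the rows keeps it nonzero. *)
have [p [q [a [b [pq0 pX qX]]]]] := real_eigenpair X k0.
set x := p *m W; set y := q *m W.
have xS : x *m S = a *: x - b *: y.
  by rewrite /x -mulmxA WS mulmxA pX mulmxBl -!scalemxAl.
have yS : y *m S = a *: y + b *: x.
  by rewrite /y -mulmxA WS mulmxA qX mulmxDl -!scalemxAl.
have xy0 : (x != 0) || (y != 0) by rewrite /x /y !mulmx_free_eq0.
have b0 : b = 0.
  have : (x *m S *m y^T) 0 0 = (y *m S *m x^T) 0 0.
    by rewrite row_dotC trmx_mul sS mulmxA.
  rewrite xS yS mulmxBl mulmxDl -!scalemxAl !mxE.
  have dE (u v : 'rV[R]_n) : \sum_j u 0 j * v^T j 0 = (u *m v^T) 0 0 by rewrite mxE.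
  rewrite !dE (row_dotC x y) => /eqP.
  rewrite (inj_eq (addrI _)) eq_sym -addr_eq0 -mulrDr mulf_eq0 => /orP[/eqP //|].
  rewrite paddr_eq0 ?row_dot_ge0 // !row_dot_eq0 => /andP[/eqP xx /eqP yy].
  by move: xy0; rewrite xx yy !eqxx.
case/orP: xy0 => w0; [exists x, a|exists y, a]; split=> //; rewrite ?submxMl //.
  by rewrite xS b0 scale0r subr0.
by rewrite yS b0 scale0r addr0.
Qed.

(** Induction on the number of rows: the orthogonal complement of the eigenrows found so far is
    stable under the symmetric [S] and nonzero while there are fewer than [n] of them, so it
    contains a further eigenvector, which is then normalised. *)
Lemma symmetric_eigenrows (R : rcfType) n (S : 'M[R]_n) k : S^T = S -> (k <= n)%N ->
  exists (V : 'M[R]_(k, n)) (d : 'rV[R]_k),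
    V *m V^T = 1%:M /\ V *m S = diag_mx d *m V.
Proof.
move=> sS; elim: k => [_|k IH kn].
  by exists 0, 0; split; apply/matrixP => -[].
have [V [d [VV VS]]] := IH (ltnW kn).
have kerV (u : 'rV[R]_n) : (u <= row_base (kermx V^T))%MS -> u *m V^T = 0.
  by rewrite eq_row_base => /sub_kermxP.
have [|||w [a [w0 /kerV wV wS]]] :=
    @symmetric_stable_eigenvector R n _ S (row_base (kermx V^T)) sS.
- rewrite mxrank_ker subn_gt0 (leq_ltn_trans _ kn) //.
  by rewrite rank_leq_col.
- exact: row_base_free.
- rewrite (eqmxMr _ (eq_row_base _)) eq_row_base; apply/sub_kermxP.
  by rewrite -mulmxA -{1}sS -trmx_mul VS trmx_mul mulmxA mulmx_ker mul0mx.
- pose c := (w *m w^T) 0 0; have c0 : 0 < c.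
    by rewrite lt_neqAle eq_sym row_dot_eq0 w0 row_dot_ge0.
  pose v := (Num.sqrt c)^-1 *: w.
  have vV : v *m V^T = 0 by rewrite -scalemxAl wV scaler0.
  have vv : v *m v^T = 1%:M.
    apply/matrixP => i j; rewrite !ord1 -scalemxAl linearZ -scalemxAr scalerA mxE -/c.
    by rewrite [RHS]mxE eqxx -invfM -expr2 sqr_sqrtr ?ltW // mulVf ?gt_eqF.
  (* The row count is restated as [1 + k], convertible to [k.+1], so that block matrices fit. *)
  suff: exists (Q : 'M[R]_(1 + k, n)) (f : 'rV[R]_(1 + k)),
      Q *m Q^T = 1%:M /\ Q *m S = diag_mx f *m Q by [].
  exists (col_mx v V), (row_mx a%:M d); split.
    rewrite tr_col_mx mul_col_row VV vv vV -(trmxK (V *m v^T)) trmx_mul trmxK vV trmx0.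
    by rewrite -scalar_mx_block.
  rewrite mul_col_mx VS diag_mx_row.
  rewrite mul_block_col !mul0mx addr0 add0r.
  congr col_mx; rewrite -scalemxAl wS scalerA mulrC -scalerA.
  by rewrite -mul_scalar_mx; congr (_ *m _); apply/matrixP => i j; rewrite !ord1 !mxE eqxx.
Qed.

Lemma symmetric_spectral (R : rcfType) n (S : 'M[R]_n) : S^T = S ->
  exists (V : 'M[R]_n) (d : 'rV[R]_n),
    [/\ V *m V^T = 1%:M, V^T *m V = 1%:M & S = V^T *m diag_mx d *m V].
Proof.
move=> sS; have [V [d [VV VS]]] := @symmetric_eigenrows R n S n sS (leqnn n).
exists V, d; split=> //; first exact: mulmx1C.
by rewrite -mulmxA -VS mulmxA (mulmx1C VV) mul1mx.
Qed.

(** The squares of [c * a i - s * b i] sum to [c * (e * c - s ^+ 2)], which is therefore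
    nonnegative; divide by [c], or note that every [b i] vanishes when [c] does. *)
Lemma sum_cauchy_schwarz (R : realFieldType) (I : finType) (a b : I -> R) :
  (\sum_i a i * b i) ^+ 2 <= (\sum_i a i ^+ 2) * (\sum_i b i ^+ 2).
Proof.
set s := \sum_i a i * b i; set c := \sum_i b i ^+ 2; set e := \sum_i a i ^+ 2.
have c0 : 0 <= c by rewrite sumr_ge0 // => i _; rewrite sqr_ge0.
have : 0 <= \sum_i (c * a i - s * b i) ^+ 2 by rewrite sumr_ge0 // => i _; rewrite sqr_ge0.
have -> : \sum_i (c * a i - s * b i) ^+ 2 = c * (e * c - s ^+ 2).
  have H x y : \sum_i (x * a i - y * b i) ^+ 2 = x ^+ 2 * (\sum_i a i ^+ 2)
      - 2 * x * y * (\sum_i a i * b i) + y ^+ 2 * (\sum_i b i ^+ 2).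
    rewrite !mulr_sumr -sumrB -big_split /=.
    by apply: eq_bigr => i _; ring.
  by rewrite H -/s -/c -/e; ring.
move: c0; rewrite le_eqVlt => /orP[/eqP c0 _|c0]; last by rewrite pmulr_rge0 // subr_ge0.
suff -> : s = 0 by rewrite expr0n /= -c0 mulr0.
rewrite /s big1 // => i _; suff -> : b i = 0 by rewrite mulr0.
move/esym/eqP: c0; rewrite psumr_eq0; last by move=> j _; rewrite sqr_ge0.
by move/allP/(_ i (mem_index_enum i)); rewrite /= sqrf_eq0 => /eqP.
Qed.

Lemma maxnorm_entry (R : realType) m n (A : 'M[R]_(m, n)) i j : `|A i j| <= maxnorm A.
Proof.
apply: (@le_trans _ _ (\big[Num.max/0]_(j' < n) `|A i j'|)).
  exact: (le_bigmax _ (fun j' => `|A i j'|)).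
exact: (le_bigmax _ (fun i' => \big[Num.max/0]_(j' < n) `|A i' j'|)).
Qed.

Lemma char_poly_orthogonal_diag (R : comNzRingType) n (V : 'M[R]_n) (d : 'rV[R]_n) :
  V *m V^T = 1%:M -> char_poly (V^T *m diag_mx d *m V) = \prod_i ('X - (d 0 i)%:P).
Proof.
move=> VV.
have VV' : map_mx polyC V^T *m map_mx polyC V = 1%:M.
  by rewrite -map_mxM (mulmx1C VV) map_scalar_mx.
rewrite /char_poly.
have -> : char_poly_mx (V^T *m diag_mx d *m V)
    = map_mx polyC V^T *m char_poly_mx (diag_mx d) *m map_mx polyC V.
  by rewrite /char_poly_mx mulmxBr mulmxBl !map_mxM scalar_mxC -(mulmxA 'X%:M) VV' mulmx1.
rewrite !det_mulmx mulrAC -det_mulmx VV' det1 mul1r.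
rewrite -/(char_poly _) char_poly_trig ?diag_mx_is_trig //.
by apply: eq_bigr => i _; rewrite mxE eqxx.
Qed.

(** Diagonalising [A^T *m A] gives the right singular vectors as rows of [V] and the squared
    singular values as [d]. Row [l] of [U] is [A] applied to row [l] of [V], of squared length
    [d 0 l]. *)
Lemma nucnorm_svd (R : realType) m n (A : 'M[R]_(m, n)) :
  exists (U : 'M[R]_(n, m)) (V : 'M[R]_n) (d : 'rV[R]_n),
    [/\ V *m V^T = 1%:M, U = V *m A^T, A = U^T *m V & U *m U^T = diag_mx d] /\
    nucnorm A = \sum_i Num.sqrt (d 0 i).
Proof.
have sS : (A^T *m A)^T = A^T *m A by rewrite trmx_mul trmxK.
have [V [d [VV VtV S]]] := symmetric_spectral sS.
exists (V *m A^T), V, d.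
have UU : V *m A^T *m (V *m A^T)^T = diag_mx d.
  by rewrite trmx_mul trmxK -mulmxA (mulmxA A^T) S !mulmxA VV mul1mx -mulmxA VV mulmx1.
split; first by split; rewrite // trmx_mul trmxK -mulmxA VtV mulmx1.
have d0 i : 0 <= d 0 i.
  move/matrixP: UU => /(_ i i); rewrite !mxE eqxx mulr1n => <-.
  by rewrite sumr_ge0 // => j _; rewrite [X in _ * X]mxE -expr2 sqr_ge0.
have cS : char_poly (A^T *m A) = \prod_i ('X - (d 0 i)%:P).
  by rewrite S char_poly_orthogonal_diag.
(* The default value 0 of [nucnorm] never occurs: the square roots of [d] form a list of singular
   values. *)
rewrite /nucnorm; case: pselect => [h|[]]; last first.
  exists [seq Num.sqrt (d 0 i) | i <- index_enum 'I_n]; split.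
    by apply/allP => _ /mapP[i _ ->]; rewrite sqrtr_ge0.
  rewrite cS big_map; apply: eq_bigr => i _.
  by rewrite sqr_sqrtr.
case: (cid h) => s [/= s0 Hs].
(* The list [s] is an arbitrary choice, but its squares and the entries of [d] are the roots of one
   polynomial, hence agree up to order; nonnegativity of [s] then undoes the squares. *)
have : perm_eq [seq x ^+ 2 | x <- s] [seq d 0 i | i <- index_enum 'I_n].
  by apply: prod_XsubC_eq; rewrite !big_map -Hs cS.
move/(perm_map Num.sqrt)/(perm_big _) => /(_ _ _ _ xpredT id) E.
rewrite -(big_map (fun i => Num.sqrt (d 0 i)) xpredT id) map_comp -E -map_comp big_map.
rewrite !big_seq; apply: eq_bigr => x xs /=.
by rewrite sqrtr_sqr ger0_norm // (allP s0).
Qed.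

(** Parseval's identity; it evaluates the truncation error one row at a time. *)
Lemma sum_sqr_orthonormal_rows (R : comNzRingType) n (V : 'M[R]_n) (c : 'I_n -> R) :
  V *m V^T = 1%:M -> \sum_j (\sum_l c l * V l j) ^+ 2 = \sum_l c l ^+ 2.
Proof.
move=> VV; pose r := \row_l c l.
have /matrixP/(_ 0 0) : (r *m V) *m (r *m V)^T = r *m r^T.
  by rewrite trmx_mul mulmxA -(mulmxA r) VV mulmx1.
rewrite !mxE => E; transitivity (\sum_j r 0 j * r^T j 0); last first.
  by apply: eq_bigr => j _; rewrite !mxE expr2.
rewrite -E; apply: eq_bigr => j _; rewrite !mxE expr2.
by congr (_ * _); apply: eq_bigr => l _; rewrite !mxE.
Qed.

(* The factors are x_l = A v_l / sqrt n and y_l = sqrt n v_l for the right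
   singular vectors v_l with singular value above t sqrt(mn); the entries of v_l
   are small because v_l = A^T A v_l / d_l. *)
Lemma nucnorm_truncation (R : realType) m n (A : 'M[R]_(m, n)) (q L t : R) :
  (0 < m)%N -> (0 < n)%N -> 0 < t ->
  nucnorm A <= q * Num.sqrt (m * n)%:R -> maxnorm A <= L ->
  exists (J : {set 'I_n}) (x : 'I_n -> 'I_m -> R) (y : 'I_n -> 'I_n -> R),
    [/\ #|J|%:R <= q / t, forall l i, `|x l i| <= L,
        forall l j, l \in J -> `|y l j| <= L / t &
        \sum_i \sum_j (A i j - \sum_(l in J) x l i * y l j) ^+ 2 <= q * t * (m * n)%:R].
Proof.
move=> m0 n0 t0 nA mA.
have [U [V [d [[VV UE AE UU] nucE]]]] := @nucnorm_svd R m n A.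
have L0 : 0 <= L.
  by apply: le_trans mA; apply: le_trans (maxnorm_entry A (Ordinal m0) (Ordinal n0)).
have AL i j : A i j ^+ 2 <= L ^+ 2.
  by rewrite -(real_normK (num_real _)) lerXn2r ?nnegrE // (le_trans (maxnorm_entry _ _ _)).
have UV l : \sum_i U l i ^+ 2 = d 0 l.
  move/matrixP: UU => /(_ l l); rewrite !mxE eqxx mulr1n => <-.
  by apply: eq_bigr => i _; rewrite mxE expr2.
have V1 l : \sum_j V l j ^+ 2 = 1.
  move/matrixP: VV => /(_ l l); rewrite !mxE eqxx mulr1n => <-.
  by apply: eq_bigr => i _; rewrite mxE expr2.
have d0 l : 0 <= d 0 l by rewrite -UV sumr_ge0 // => i _; rewrite sqr_ge0.
have Ub l i : U l i ^+ 2 <= n%:R * L ^+ 2.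
  have -> : U l i = \sum_j V l j * A i j.
    by rewrite UE mxE; apply: eq_bigr => j _; rewrite mxE.
  apply: le_trans (sum_cauchy_schwarz _ _) _; rewrite V1 mul1r.
  apply: (@le_trans _ _ (\sum_(j < n) L ^+ 2)); first exact: ler_sum.
  by rewrite sumr_const card_ord mulr_natl.
(* Since [U l] has squared length [d 0 l], Cauchy-Schwarz leaves only one factor [d 0 l] on the
   right; cancelling it later bounds [V l j ^+ 2] by [m L^2 / d_l]. *)
have dV l j : (d 0 l * V l j) ^+ 2 <= d 0 l * (m%:R * L ^+ 2).
  have -> : d 0 l * V l j = \sum_i U l i * A i j.
    have /matrixP/(_ l j) : U *m A = diag_mx d *m V by rewrite {1}AE mulmxA UU.
    by rewrite mul_diag_mx !mxE => <-.
  apply: le_trans (sum_cauchy_schwarz _ _) _; rewrite UV ler_wpM2l //.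
  apply: (@le_trans _ _ (\sum_(j < m) L ^+ 2)); first exact: ler_sum.
  by rewrite sumr_const card_ord mulr_natl.
have AUV i j : A i j = \sum_l U l i * V l j.
  by rewrite {1}AE mxE; apply: eq_bigr => l _; rewrite mxE.
set s := Num.sqrt (m * n)%:R in nA.
have s0 : 0 < s by rewrite sqrtr_gt0 ltr0n muln_gt0 m0.
have s2 : s ^+ 2 = (m * n)%:R by rewrite sqr_sqrtr ?ler0n.
have ts0 : 0 < t * s by rewrite mulr_gt0.
have n0' : 0 < n%:R :> R by rewrite ltr0n.
have m0' : 0 < m%:R :> R by rewrite ltr0n.
pose J := finset (fun l => t * s < Num.sqrt (d 0 l)).
have rn0 : 0 < Num.sqrt n%:R :> R by rewrite sqrtr_gt0.
exists J, (fun l i => U l i / Num.sqrt n%:R), (fun l j => Num.sqrt n%:R * V l j); split.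
(* Each index in [J] contributes at least [t * s] to the nuclear norm, which is at most [q * s]. *)
- rewrite ler_pdivlMr // -(ler_pM2r s0) -mulrA (le_trans _ nA) // nucE.
  rewrite (bigID (mem J)) /= -[leLHS]addr0 lerD ?sumr_ge0 //.
  rewrite mulr_natl -sumr_const; apply: ler_sum => l; rewrite inE; exact: ltW.
- move=> l i; rewrite normrM normfV (ger0_norm (ltW rn0)) ler_pdivrMr //.
  rewrite -(ler_pXn2r (n:=2)) ?nnegrE ?mulr_ge0 ?(ltW rn0) //.
  rewrite exprMn sqr_sqrtr ?ler0n // real_normK ?num_real //.
  by rewrite [leRHS]mulrC Ub.
- move=> l j; rewrite inE => lJ.
  rewrite normrM (ger0_norm (ltW rn0)) ler_pdivlMr //.
  rewrite -(ler_pXn2r (n:=2)) ?nnegrE ?mulr_ge0 ?(ltW rn0) ?(ltW t0) //.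
  rewrite !exprMn sqr_sqrtr ?ler0n // real_normK ?num_real //.
  have dl : 0 < d 0 l by rewrite -sqrtr_gt0 (lt_trans _ lJ).
  have tsd : t ^+ 2 * (m%:R * n%:R) < d 0 l.
    rewrite -natrM -s2 -exprMn -(sqr_sqrtr (d0 l)).
    by rewrite ltr_pXn2r ?nnegrE ?sqrtr_ge0 // ltW.
  have := dV l j; rewrite exprMn [d 0 l ^+ 2]expr2 -(mulrA (d 0 l)) ler_pM2l // => dVl.
  rewrite -(ler_pM2l m0'); apply: le_trans dVl.
  have -> : m%:R * (n%:R * V l j ^+ 2 * t ^+ 2) = (t ^+ 2 * (m%:R * n%:R)) * V l j ^+ 2 by ring.
  by rewrite ler_wpM2r ?sqr_ge0 // ltW.
(* These are the coordinates of row [i] of the remainder in the orthonormal basis [V]. *)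
- pose c i l := if l \in J then 0 else U l i.
  have E i j : A i j - \sum_(l in J) U l i / Num.sqrt n%:R * (Num.sqrt n%:R * V l j)
      = \sum_l c i l * V l j.
    rewrite AUV [X in X - _](bigID (mem J)) /= [RHS](bigID (mem J)) /=.
    rewrite [X in _ = X + _]big1 => [|l lJ]; last by rewrite /c lJ mul0r.
    rewrite add0r addrAC (_ : _ - _ = 0) ?add0r.
      by apply: eq_bigr => l /negbTE lJ; rewrite /c lJ.
    apply/eqP; rewrite subr_eq0; apply/eqP; apply: eq_bigr => l _.
    by rewrite mulrA divfK // gt_eqF.
  under eq_bigr do under eq_bigr do rewrite E.
  under eq_bigr do rewrite sum_sqr_orthonormal_rows //.
  rewrite exchange_big /=.
  (* Outside [J] one factor of [d 0 l = sqrt (d 0 l) ^+ 2] is at most [t * s]; the other sums to the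
     nuclear norm. *)
  apply: (@le_trans _ _ (\sum_l t * s * Num.sqrt (d 0 l))).
    apply: ler_sum => l _; rewrite /c; case: (boolP (l \in J)) => lJ.
      by rewrite big1 ?mulr_ge0 ?sqrtr_ge0 ?(ltW t0) ?(ltW s0) // => i _; rewrite expr0n.
    rewrite UV -[leLHS](sqr_sqrtr (d0 l)) expr2 ler_wpM2r ?sqrtr_ge0 //.
    by move: lJ; rewrite inE -leNgt.
  rewrite -mulr_sumr -nucE; apply: le_trans (ler_wpM2l (ltW ts0) nA) _.
  by rewrite -s2 le_eqVlt; apply/orP; left; apply/eqP; ring.
Qed.

(** * The cut norm *)

Lemma cutnorm_bilinear (R : realType) m n (E : 'M[R]_(m, n)) (u : 'I_m -> R) (v : 'I_n -> R) :
  (0 < m)%N -> (0 < n)%N -> (forall i, `|u i| <= 1) -> (forall j, `|v j| <= 1) ->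
  `|\sum_i \sum_j u i * v j * E i j| <= (m * n)%:R * cutnorm E.
Proof.
move=> m0 n0 u1 v1.
rewrite /cutnorm mulrA mulfV ?mul1r ?pnatr_eq0 ?muln_eq0 -?lt0n ?negb_or -?lt0n ?m0 ?n0 //.
have formE (x : 'cV[R]_m) (y : 'cV[R]_n) :
    (x^T *m E *m y) 0 0 = \sum_i \sum_j x i 0 * y j 0 * E i j.
  rewrite exchange_big mxE /=; apply: eq_bigr => j _.
  by rewrite mxE mulr_suml; apply: eq_bigr => i _; rewrite !mxE mulrAC.
(* The supremum dominates the members of its set only if the set is bounded above; the sum of the
   absolute values of the entries is a bound. *)
apply: ub_le_sup.
  exists (\sum_i \sum_j `|E i j|) => _ [x [y [x1 [y1 ->]]]].
  rewrite formE; apply: le_trans (ler_norm_sum _ _ _) _; apply: ler_sum => i _.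
  apply: le_trans (ler_norm_sum _ _ _) _; apply: ler_sum => j _.
  by rewrite !normrM -[leRHS]mul1r ler_wpM2r // mulr_ile1.
exists (\col_i u i), (\col_j v j); split; [|split].
- by move=> i; rewrite mxE.
- by move=> j; rewrite mxE.
by rewrite formE; congr `| _ |; apply: eq_bigr => i _; apply: eq_bigr => j _; rewrite !mxE.
Qed.

Lemma cutnorm_bilinear_scaled (R : realType) m n (E : 'M[R]_(m, n)) (u : 'I_m -> R)
    (v : 'I_n -> R) (a b : R) :
  (0 < m)%N -> (0 < n)%N -> 0 < a -> 0 < b ->
  (forall i, `|u i| <= a) -> (forall j, `|v j| <= b) ->
  `|\sum_i \sum_j u i * v j * E i j| <= a * b * ((m * n)%:R * cutnorm E).
Proof.
move=> m0 n0 a0 b0 ua vb.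
have -> : \sum_i \sum_j u i * v j * E i j =
    a * b * \sum_i \sum_j (u i / a) * (v j / b) * E i j.
  rewrite mulr_sumr; apply: eq_bigr => i _; rewrite mulr_sumr; apply: eq_bigr => j _.
  by field; rewrite !gt_eqF.
rewrite normrM gtr0_norm ?mulr_gt0 // ler_pM2l ?mulr_gt0 //.
by apply: cutnorm_bilinear => // [i|j];
  rewrite normrM normfV ?(gtr0_norm a0) ?(gtr0_norm b0) ler_pdivrMr // mul1r.
Qed.

(** The entrywise product of two rank-one matrices has rank one again, with factors [x l * z k] and
    [y l * w k] bounded by [a ^+ 2] and [b ^+ 2]; each of the [#|J| * #|K|] products is one test of
    the cut norm. *)
Lemma cutnorm_low_rank (R : realType) m n (E : 'M[R]_(m, n)) (I1 I2 : finType)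
    (J : {set I1}) (K : {set I2}) (x : I1 -> 'I_m -> R) (y : I1 -> 'I_n -> R)
    (z : I2 -> 'I_m -> R) (w : I2 -> 'I_n -> R) (a b : R) :
  (0 < m)%N -> (0 < n)%N -> 0 < a -> 0 < b ->
  (forall l i, l \in J -> `|x l i| <= a) -> (forall l j, l \in J -> `|y l j| <= b) ->
  (forall l i, l \in K -> `|z l i| <= a) -> (forall l j, l \in K -> `|w l j| <= b) ->
  `|\sum_i \sum_j (\sum_(l in J) x l i * y l j) * (\sum_(l in K) z l i * w l j) * E i j|
    <= #|J|%:R * #|K|%:R * (a ^+ 2 * b ^+ 2 * ((m * n)%:R * cutnorm E)).
Proof.
move=> m0 n0 a0 b0 xa yb za wb.
have -> : \sum_i \sum_j (\sum_(l in J) x l i * y l j) * (\sum_(l in K) z l i * w l j) * E i j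
    = \sum_(l in J) \sum_(k in K) \sum_i \sum_j
        (x l i * z k i) * (y l j * w k j) * E i j.
  under eq_bigr => i _.
    under eq_bigr => j _.
      rewrite mulr_suml mulr_suml; under eq_bigr => l _ do
        rewrite mulr_sumr mulr_suml.
      over.
    rewrite exchange_big /=.
    under eq_bigr => l _ do rewrite exchange_big /=.
    over.
  rewrite exchange_big; apply: eq_bigr => l _ /=.
  rewrite exchange_big; apply: eq_bigr => k _ /=.
  by apply: eq_bigr => i _; apply: eq_bigr => j _; ring.
rewrite -mulrA [_ * (_ * _)]mulr_natl -sumr_const.
apply: le_trans (ler_norm_sum _ _ _) _; apply: ler_sum => l lJ.
rewrite mulr_natl -sumr_const.
apply: le_trans (ler_norm_sum _ _ _) _; apply: ler_sum => k kK.
apply: cutnorm_bilinear_scaled; rewrite ?exprn_gt0 //.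
  by move=> i; rewrite normrM expr2 ler_pM // ?xa ?za.
by move=> j; rewrite normrM expr2 ler_pM // ?yb ?wb.
Qed.

Lemma sum_permute (R : nmodType) m n (F : 'I_m -> 'I_n -> R) (pi : {perm 'I_m})
    (tau : {perm 'I_n}) :
  \sum_i \sum_j F (pi i) (tau j) = \sum_i \sum_j F i j.
Proof.
rewrite [RHS](reindex_inj (@perm_inj _ pi)); apply: eq_bigr => i _.
by rewrite [RHS](reindex_inj (@perm_inj _ tau)).
Qed.

Lemma cutdist_lt (R : realType) m n (A B : 'M[R]_(m, n)) (e : R) : cutdist A B < e ->
  exists pi tau, cutnorm (permute_mx A pi tau - B) < e.
Proof.
move=> /inf_lt[|_ [pi [tau ->]] lte]; last by exists pi, tau.
by exists (cutnorm (permute_mx A 1%g 1%g - B)), 1%g, 1%g.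
Qed.

(** With [D = a - b], [D1 = a1 - b1] and [d2 = D - D1]: first [D^2 w <= 2 D1^2 w + 2 d2^2], then [w]
    is traded for [p] at the cost [- 2 D1^2 (p - w)], and [2 D1^2 p <= 4 D^2 p + 4 d2^2]. Splitting
    [6 d2^2] gives the constants 12. *)
Lemma weighted_sqr_diff_le (R : realFieldType) (a b a1 b1 w p : R) :
  0 <= p <= 1 -> 0 <= w <= 1 ->
  (a - b) ^+ 2 * w <= 4 * ((a - b) ^+ 2 * p) + 12 * (a - a1) ^+ 2 + 12 * (b - b1) ^+ 2
    + - 2 * (a1 * a1 * (p - w)) + 4 * (a1 * b1 * (p - w)) + - 2 * (b1 * b1 * (p - w)).
Proof.
move=> /andP[p0 p1] /andP[w0 w1].
pose d2 := (a - a1) - (b - b1).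
have h1 : 0 <= ((a1 - b1) - d2) ^+ 2 * w by rewrite mulr_ge0 ?sqr_ge0.
have h2 : 0 <= d2 ^+ 2 * (1 - w) by rewrite mulr_ge0 ?sqr_ge0 ?subr_ge0.
have h3 : 0 <= ((a - b) + d2) ^+ 2 * p by rewrite mulr_ge0 ?sqr_ge0.
have h4 : 0 <= d2 ^+ 2 * (1 - p) by rewrite mulr_ge0 ?sqr_ge0 ?subr_ge0.
have h5 : 0 <= ((a - a1) + (b - b1)) ^+ 2 by rewrite sqr_ge0.
by rewrite /d2 in h1 h2 h3 h4; lra.
Qed.

(** The truncations of [A] and [B] are permuted along with [P], which preserves the bounds on their
    factors. The two truncation errors give [24 = 12 + 12], the three cut norm terms
    [8 = 2 + 4 + 2]. *)
Lemma weighted_diff_bound (R : realType) m n (A B P W : 'M[R]_(m, n)) (q L t : R)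
    (pi : {perm 'I_m}) (tau : {perm 'I_n}) :
  (0 < m)%N -> (0 < n)%N -> 0 < t -> 0 < L ->
  nucnorm A <= q * Num.sqrt (m * n)%:R -> nucnorm B <= q * Num.sqrt (m * n)%:R ->
  maxnorm A <= L -> maxnorm B <= L ->
  (forall i j, 0 <= P i j <= 1) -> (forall i j, 0 <= W i j <= 1) ->
  \sum_i \sum_j (A (pi i) (tau j) - B (pi i) (tau j)) ^+ 2 * W i j <=
    4 * (\sum_i \sum_j (A i j - B i j) ^+ 2 * P i j) +
    (24 * q * t + 8 * ((q / t) ^+ 2 * (L ^+ 2 * (L / t) ^+ 2)) *
       cutnorm (permute_mx P pi tau - W)) * (m * n)%:R.
Proof.
move=> m0 n0 t0 L0 nA nB mA mB P01 W01.
have [J [x [y [cJ xL yL hA]]]] := nucnorm_truncation m0 n0 t0 nA mA.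
have [K [z [w [cK zL wL hB]]]] := nucnorm_truncation m0 n0 t0 nB mB.
pose A1 i j := \sum_(l in J) x l i * y l j.
pose B1 i j := \sum_(l in K) z l i * w l j.
set E := permute_mx P pi tau - W.
set c := cutnorm E; set N : R := (m * n)%:R.
pose b := (q / t) ^+ 2 * (L ^+ 2 * (L / t) ^+ 2 * (N * c)).
have Lt0 : 0 < L / t by rewrite divr_gt0.
have cut0 : 0 <= N * c.
  have := @cutnorm_bilinear R m n E (fun=> 0) (fun=> 0) m0 n0.
  by rewrite normr0 => H; apply: le_trans (H _ _).
(* Nonnegativity of the cut norm, seen by testing with zero vectors, allows the ranks to be replaced
   by their bound [q / t]. *)
have rank2 (r s : nat) (v : R) : r%:R <= q / t -> s%:R <= q / t ->
    v <= r%:R * s%:R * (L ^+ 2 * (L / t) ^+ 2 * (N * c)) -> v <= b.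
  move=> rq sq /le_trans; apply; apply: ler_wpM2r; last by rewrite expr2 ler_pM.
  by rewrite mulr_ge0 // mulr_ge0 ?sqr_ge0.
have AA : `|\sum_i \sum_j A1 (pi i) (tau j) * A1 (pi i) (tau j) * E i j| <= b.
  by apply: (rank2 _ _ _ cJ cJ); apply: cutnorm_low_rank => // *; rewrite ?xL ?yL.
have AB : `|\sum_i \sum_j A1 (pi i) (tau j) * B1 (pi i) (tau j) * E i j| <= b.
  by apply: (rank2 _ _ _ cJ cK); apply: cutnorm_low_rank => // *;
    rewrite ?xL ?yL ?zL ?wL.
have BB : `|\sum_i \sum_j B1 (pi i) (tau j) * B1 (pi i) (tau j) * E i j| <= b.
  by apply: (rank2 _ _ _ cK cK); apply: cutnorm_low_rank => // *; rewrite ?zL ?wL.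
apply: (@le_trans _ _ (\sum_i \sum_j (
    4 * ((A (pi i) (tau j) - B (pi i) (tau j)) ^+ 2 * P (pi i) (tau j))
  + 12 * (A (pi i) (tau j) - A1 (pi i) (tau j)) ^+ 2
  + 12 * (B (pi i) (tau j) - B1 (pi i) (tau j)) ^+ 2
  + - 2 * (A1 (pi i) (tau j) * A1 (pi i) (tau j) * E i j)
  + 4 * (A1 (pi i) (tau j) * B1 (pi i) (tau j) * E i j)
  + - 2 * (B1 (pi i) (tau j) * B1 (pi i) (tau j) * E i j)))).
  apply: ler_sum => i _; apply: ler_sum => j _.
  rewrite [E i j]mxE [permute_mx _ _ _ i j]mxE [(- W) i j]mxE.
  exact: weighted_sqr_diff_le.
have sumE (F1 F2 F3 F4 F5 F6 : 'I_m -> 'I_n -> R) :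
  \sum_i \sum_j (4 * F1 i j + 12 * F2 i j + 12 * F3 i j + - 2 * F4 i j + 4 * F5 i j
     + - 2 * F6 i j) =
  4 * (\sum_i \sum_j F1 i j) + 12 * (\sum_i \sum_j F2 i j) + 12 * (\sum_i \sum_j F3 i j)
  + - 2 * (\sum_i \sum_j F4 i j) + 4 * (\sum_i \sum_j F5 i j) + - 2 * (\sum_i \sum_j F6 i j).
  by rewrite !mulr_sumr -!big_split; apply: eq_bigr => i _; rewrite !mulr_sumr -!big_split.
rewrite (sumE (fun i j => (A (pi i) (tau j) - B (pi i) (tau j)) ^+ 2 * P (pi i) (tau j))
  (fun i j => (A (pi i) (tau j) - A1 (pi i) (tau j)) ^+ 2)
  (fun i j => (B (pi i) (tau j) - B1 (pi i) (tau j)) ^+ 2)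
  (fun i j => A1 (pi i) (tau j) * A1 (pi i) (tau j) * E i j)
  (fun i j => A1 (pi i) (tau j) * B1 (pi i) (tau j) * E i j)
  (fun i j => B1 (pi i) (tau j) * B1 (pi i) (tau j) * E i j)).
rewrite (sum_permute (fun i j => (A i j - B i j) ^+ 2 * P i j)).
rewrite (sum_permute (fun i j => (A i j - A1 i j) ^+ 2)).
rewrite (sum_permute (fun i j => (B i j - B1 i j) ^+ 2)).
move: AA AB BB; rewrite !ler_norml => /andP[AA1 AA2] /andP[AB1 AB2] /andP[BB1 BB2].
move: hA hB; rewrite -/N => hA hB.
have -> : (24 * q * t + 8 * ((q / t) ^+ 2 * (L ^+ 2 * (L / t) ^+ 2)) * c) * N
  = 24 * (q * t * N) + 8 * b by rewrite /b; ring.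
by lra.
Qed.

(** * Sublevel sets of a graphon and grid cells *)

Section Plane.
Variable R : realType.

(** The same product as [leb2], typed as a measure so that lemmas on measures apply; the two are
    exchanged by conversion. *)
Let mu : {measure set (measurableTypeR R * measurableTypeR R) -> \bar R} :=
  ((@lebesgue_measure R) \x (@lebesgue_measure R))%E.

Lemma leb2_itv (i j : interval R) : (leb2 ([set` i] `*` [set` j]) =
  lebesgue_measure [set` i] * lebesgue_measure [set` j])%E.
Proof. by rewrite /leb2 product_measure1E. Qed.

Lemma unit_sqE : @unit_sq R = [set` `[0, 1]%R] `*` [set` `[0, 1]%R].
Proof. by []. Qed.

Lemma measurable_unit_sq : measurable (@unit_sq R).
Proof. by rewrite unit_sqE; apply: measurableX. Qed.

Lemma leb2_unit_sq : leb2 (@unit_sq R) = 1%E.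
Proof.
by rewrite unit_sqE leb2_itv !lebesgue_measure_itv /= lte01 oppr0 adde0 mule1.
Qed.

Lemma measurable_graphon_lt (W : R * R -> R) (k : R) : measurable_fun (@unit_sq R) W ->
  measurable [set z | unit_sq z /\ W z < k].
Proof.
move=> mW; have := mW measurable_unit_sq [set` `]-oo, k[%R] (measurable_itv _).
by congr measurable; apply/seteqP; split=> z /=; rewrite in_itv.
Qed.

(* Continuity from above of the measure along the sublevel sets {W < 1/(k+1)}. *)
Lemma small_sublevel (W : R * R -> R) (e : R) : graphon W -> nonzero_ae W -> 0 < e ->
  exists2 k : R, 0 < k & (leb2 [set z | unit_sq z /\ (W z < k)%R] <= e%:E)%E.
Proof.
move=> [mW W01] W0 e0.
pose F (k : nat) := [set z | unit_sq z /\ W z < k.+1%:R^-1].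
have mF k : measurable (F k) by exact: measurable_graphon_lt.
have FI : \bigcap_k F k = [set z | unit_sq z /\ W z = 0].
  apply/seteqP; split=> z /=.
    move=> Fz; have [uz _] := Fz 0%N I; split=> //.
    have /andP[Wz0 _] := W01 _ uz; apply/eqP; rewrite eq_le Wz0 andbT leNgt; apply/negP => Wz.
    have [k _ /(_ k (leqnn k)) /= Hk] := near_infty_natSinv_lt (PosNum Wz).
    by have [_ /ltW] := Fz k I; rewrite leNgt Hk.
  by move=> [uz Wz] k _; split=> //; rewrite Wz invr_gt0 ltr0n.
(* Continuity from above requires a set of finite measure. *)
have F0 : (mu (F 0%N) < +oo)%E.
  apply: (@le_lt_trans _ _ (mu (@unit_sq R))); last by rewrite [mu _]leb2_unit_sq ltry.
  by apply: le_measure; rewrite ?inE; [exact: mF|exact: measurable_unit_sq|move=> z []].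
have : mu \o F @ \oo --> mu (\bigcap_k F k).
  apply: nonincreasing_cvg_mu => //; first exact: bigcapT_measurable.
  move=> a b ab; apply/subsetPset => z [uz Wz]; split=> //; apply: lt_le_trans Wz _.
  by rewrite lef_pV2 ?posrE ?ltr0n // ler_nat ltnS.
rewrite FI [X in _ --> X]W0 => /fine_cvgP[Ffin /cvgrPdist_lt /(_ e e0) Fe].
have [k _ /(_ k (leqnn k)) [fk ek]] := filterI Ffin Fe.
exists k.+1%:R^-1; first by rewrite invr_gt0 ltr0n.
rewrite -[leb2 _](fineK fk) lee_fin ltW //.
move: ek; rewrite sub0r normrN; exact: le_lt_trans (ler_norm _).
Qed.

(* [graphon_mx] integrates over closed cells, which overlap; their left-open
   versions are disjoint, so the measures of their traces on a set add up. *)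
Definition lo_cell (m n i j : nat) : set (R * R) :=
  [set` `]i%:R / m%:R, i.+1%:R / m%:R]%R] `*` [set` `]j%:R / n%:R, j.+1%:R / n%:R]%R].

Definition cl_cell (m n i j : nat) : set (R * R) :=
  [set` `[i%:R / m%:R, i.+1%:R / m%:R]%R] `*` [set` `[j%:R / n%:R, j.+1%:R / n%:R]%R].

Lemma measurable_lo_cell m n i j : measurable (lo_cell m n i j).
Proof. exact: measurableX. Qed.

Lemma measurable_cl_cell m n i j : measurable (cl_cell m n i j).
Proof. exact: measurableX. Qed.

Lemma lo_cell_cl m n i j : lo_cell m n i j `<=` cl_cell m n i j.
Proof.
move=> z [] /=; rewrite !in_itv /= => /andP[/ltW a b] /andP[/ltW c d].
by split; rewrite /= in_itv /= ?a ?c.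
Qed.

Lemma cl_cell_unit m n i j : (i < m)%N -> (j < n)%N -> cl_cell m n i j `<=` @unit_sq R.
Proof.
have le01 (p k : nat) (x : R) : (k < p)%N -> k%:R / p%:R <= x <= k.+1%:R / p%:R -> 0 <= x <= 1.
  move=> kp /andP[x0 x1]; have p0 : 0 < p%:R :> R by rewrite ltr0n (leq_trans _ kp).
  rewrite (le_trans _ x0) ?divr_ge0 ?ler0n //= (le_trans x1) //.
  by rewrite ler_pdivrMr // mul1r ler_nat.
move=> im jn z [] /=; rewrite !in_itv /= => /(le01 _ _ _ im) h1 /(le01 _ _ _ jn) h2.
by split; rewrite in_itv.
Qed.

Lemma itv_length (p k : nat) : (0 < p)%N ->
  (k%:R / p%:R < k.+1%:R / p%:R :> R) /\ k.+1%:R / p%:R - k%:R / p%:R = p%:R^-1 :> R.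
Proof.
move=> p0; have p0' : 0 < p%:R :> R by rewrite ltr0n.
rewrite ltr_pM2r ?invr_gt0 // ltr_nat ltnSn; split=> //.
by rewrite -mulrBl -natr1 addrAC subrr add0r mul1r.
Qed.

Lemma leb2_lo_cell m n i j : (0 < m)%N -> (0 < n)%N ->
  leb2 (lo_cell m n i j) = ((m * n)%:R^-1)%:E.
Proof.
move=> m0 n0; have [a1 a2] := itv_length i m0; have [b1 b2] := itv_length j n0.
rewrite leb2_itv !lebesgue_measure_itv /= !lte_fin a1 b1 -!EFinB a2 b2 -EFinM.
by rewrite natrM invfM.
Qed.

Lemma leb2_cl_cell m n i j : (0 < m)%N -> (0 < n)%N ->
  leb2 (cl_cell m n i j) = ((m * n)%:R^-1)%:E.
Proof.
move=> m0 n0; have [a1 a2] := itv_length i m0; have [b1 b2] := itv_length j n0.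
rewrite leb2_itv !lebesgue_measure_itv /= !lte_fin a1 b1 -!EFinB a2 b2 -EFinM.
by rewrite natrM invfM.
Qed.

Lemma lo_cell_trivIset m n (D : set ('I_m * 'I_n)) :
  trivIset D (fun p => lo_cell m n p.1 p.2).
Proof.
(* From [a < p x <= b + 1] follows [a <= b]; by symmetry a point determines the index of its
   left-open interval. *)
have aux (p a b : nat) (x : R) : (0 < p)%N ->
    a%:R / p%:R < x <= a.+1%:R / p%:R -> b%:R / p%:R < x <= b.+1%:R / p%:R -> (a <= b)%N.
  move=> p0 /andP[xa _] /andP[_ xb]; have := lt_le_trans xa xb.
  by rewrite ltr_pM2r ?invr_gt0 ?ltr0n // ltr_nat ltnS.
move=> [i j] [i' j'] _ _ [z [[/= a1 b1] [/= a2 b2]]].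
move: a1 b1 a2 b2; rewrite !in_itv /= => a1 b1 a2 b2.
have m0 : (0 < m)%N by apply: leq_ltn_trans (ltn_ord i).
have n0 : (0 < n)%N by apply: leq_ltn_trans (ltn_ord j).
by congr pair; apply/val_inj/eqP; rewrite eqn_leq /= ?(aux _ _ _ _ m0 a1 a2)
  ?(aux _ _ _ _ m0 a2 a1) ?(aux _ _ _ _ n0 b1 b2) ?(aux _ _ _ _ n0 b2 b1).
Qed.

Lemma sum_leb2_lo_cell m n (S : set (R * R)) : measurable S ->
  (\sum_(p : 'I_m * 'I_n) leb2 (lo_cell m n p.1 p.2 `&` S) <= leb2 S)%E.
Proof.
move=> mS.
have -> : (\sum_(p : 'I_m * 'I_n) leb2 (lo_cell m n p.1 p.2 `&` S) =
    \sum_(p \in [set` index_enum ('I_m * 'I_n)%type]) mu (lo_cell m n p.1 p.2 `&` S))%E.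
  by rewrite -fsbig_seq ?index_enum_uniq.
have mLS (p : 'I_m * 'I_n) : measurable (lo_cell m n p.1 p.2 `&` S).
  by apply: measurableI => //; exact: measurable_lo_cell.
rewrite -measure_fin_bigcup //=.
- apply: le_measure; rewrite ?inE //; last by move=> z [p _ []].
  by apply: fin_bigcup_measurable => [|p _]; [exact: finite_seq|exact: mLS].
- by apply: trivIset_setIr; exact: lo_cell_trivIset.
- by move=> p _; exact: mLS.
Qed.

Section Cells.
Variables (W : R * R -> R) (m n : nat).
Hypothesis gW : graphon W.

Lemma measurable_graphon_cl_cell i j : (i < m)%N -> (j < n)%N ->
  measurable_fun (cl_cell m n i j) (EFin \o W).
Proof.
move=> im jn; apply/measurable_EFinP; apply: (measurable_funS _ (cl_cell_unit im jn) gW.1).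
exact: measurable_unit_sq.
Qed.

Lemma graphon_cl_cell i j z : (i < m)%N -> (j < n)%N -> cl_cell m n i j z -> 0 <= W z <= 1.
Proof. by move=> im jn /(cl_cell_unit im jn); apply: gW.2. Qed.

Lemma integral_cl_cell_le i j : (i < m)%N -> (j < n)%N ->
  (\int[@leb2 R]_(z in cl_cell m n i j) (W z)%:E <= ((m * n)%:R^-1)%:E)%E.
Proof.
move=> im jn; rewrite -(@leb2_cl_cell m n i j) ?(leq_ltn_trans _ im) ?(leq_ltn_trans _ jn) //.
rewrite -[leRHS]mul1e -(@integral_cst _ _ _ mu) //; last exact: measurable_cl_cell.
apply: (@ge0_le_integral _ _ _ mu) => //.
- exact: measurable_cl_cell.
- by move=> z /(graphon_cl_cell im jn) /andP[]; rewrite lee_fin.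
- exact: measurable_graphon_cl_cell.
- by move=> z /(graphon_cl_cell im jn) /andP[]; rewrite lee_fin.
Qed.

Lemma integral_cl_cell_fin i j : (i < m)%N -> (j < n)%N ->
  (\int[@leb2 R]_(z in cl_cell m n i j) (W z)%:E)%E \is a fin_num.
Proof.
move=> im jn; rewrite ge0_fin_numE.
  by apply: le_lt_trans (integral_cl_cell_le im jn) _; rewrite ltry.
by apply: integral_ge0 => z /(graphon_cl_cell im jn) /andP[]; rewrite lee_fin.
Qed.

Lemma graphon_mxE (i : 'I_m) (j : 'I_n) : graphon_mx W m n i j =
  (m * n)%:R * fine (\int[@leb2 R]_(z in cl_cell m n i j) (W z)%:E).
Proof. by rewrite mxE. Qed.

(** A cell has area [1 / (m n)], so each entry is the mean of [W] over its cell. *)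
Lemma graphon_mx01 (i : 'I_m) (j : 'I_n) : 0 <= graphon_mx W m n i j <= 1.
Proof.
have [im jn] := (ltn_ord i, ltn_ord j).
have N0 : 0 < (m * n)%:R :> R.
  by rewrite ltr0n muln_gt0 (leq_ltn_trans _ im) // (leq_ltn_trans _ jn).
rewrite graphon_mxE; apply/andP; split.
  rewrite mulr_ge0 ?ler0n // fine_ge0 // integral_ge0 // => z.
  by move=> /(graphon_cl_cell im jn) /andP[]; rewrite lee_fin.
rewrite -[leRHS](divff (lt0r_neq0 N0)) ler_pM2l // -lee_fin fineK ?integral_cl_cell_fin //.
exact: integral_cl_cell_le.
Qed.

(* Markov's inequality on one cell. *)
Lemma lo_cell_sublevel (k : R) (i : 'I_m) (j : 'I_n) : 0 < k ->
  1 <= (m * n)%:R * fine (leb2 (lo_cell m n i j `&` [set z | unit_sq z /\ W z < k]))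
    + k^-1 * graphon_mx W m n i j.
Proof.
move=> k0; have [im jn] := (ltn_ord i, ltn_ord j).
set S := [set z | _]; have mS : measurable S := measurable_graphon_lt k gW.1.
set H := lo_cell m n i j; have mH : measurable H := measurable_lo_cell m n i j.
have m0 : (0 < m)%N by apply: leq_ltn_trans im.
have n0 : (0 < n)%N by apply: leq_ltn_trans jn.
have N0 : 0 < (m * n)%:R :> R by rewrite ltr0n muln_gt0 m0.
have mHS : measurable (H `\` S) by exact: measurableD.
have HE : (((m * n)%:R^-1)%:E = leb2 (H `\` S) + leb2 (H `&` S))%E.
  by rewrite -(@leb2_lo_cell m n i j) //; exact: (@measureDI _ _ _ mu).
(* Points of [H] outside [S] lie in the unit square and satisfy [W >= k]; passing to the closed cell
   can only increase the integral of the nonnegative [W]. *)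
have IC : (k%:E * leb2 (H `\` S) <= \int[@leb2 R]_(z in cl_cell m n i j) (W z)%:E)%E.
  rewrite -(@integral_cst _ _ _ mu) //.
  apply: (@le_trans _ _ (\int[mu]_(z in H `\` S) (W z)%:E)%E).
    apply: (@ge0_le_integral _ _ _ mu) => //.
    - by move=> z _; rewrite lee_fin ltW.
    - apply: (measurable_funS _ _ (measurable_graphon_cl_cell im jn)).
        exact: measurable_cl_cell.
      by move=> z [/lo_cell_cl].
    - move=> z [/lo_cell_cl/(cl_cell_unit im jn) uz nS]; rewrite lee_fin leNgt.
      by apply/negP => Wz; apply: nS; split.
  apply: (@ge0_subset_integral _ _ _ mu) => //.
  - exact: measurable_cl_cell.
  - exact: measurable_graphon_cl_cell.
  - by move=> z /(graphon_cl_cell im jn) /andP[]; rewrite lee_fin.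
  - by move=> z [/lo_cell_cl].
have finH (X : set (R * R)) : measurable X -> X `<=` H -> leb2 X \is a fin_num.
  move=> mX XH; rewrite -[leb2 X]/(mu X) ge0_fin_numE ?measure_ge0 //.
  apply: (@le_lt_trans _ _ (mu H)); first by apply: le_measure; rewrite ?inE.
  by rewrite [mu _]leb2_lo_cell // ltry.
have finD := finH _ mHS (@subDsetl _ _ _).
have finI := finH _ (measurableI _ _ mH mS) (@subIsetl _ _ _).
rewrite graphon_mxE.
move: IC HE; rewrite -(fineK finD) -(fineK finI) -(fineK (integral_cl_cell_fin im jn)).
rewrite -EFinM -EFinD lee_fin => IC [HE].
move: IC; rewrite mulrC -ler_pdivlMr // => IC.
rewrite /= -[leLHS](mulfV (lt0r_neq0 N0)) HE mulrDr addrC lerD2l mulrCA ler_pM2l //.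
by rewrite [leRHS]mulrC.
Qed.

(** The cellwise Markov bound is multiplied by [F i j] and summed. In the sublevel term [F] is
    replaced by [M], and disjointness of the left-open cells bounds the total measure by [s]. *)
Lemma mean_le_graphon_mean (F : 'I_m -> 'I_n -> R) (M k s : R) : 0 < k -> 0 <= M ->
  (forall i j, 0 <= F i j <= M) ->
  (leb2 [set z | unit_sq z /\ (W z < k)%R] <= s%:E)%E ->
  \sum_i \sum_j F i j <= (m * n)%:R * (M * s)
    + k^-1 * \sum_i \sum_j F i j * graphon_mx W m n i j.
Proof.
move=> k0 M0 FM; set S := [set z | _] => Ss.
have mS : measurable S := measurable_graphon_lt k gW.1.
pose c (i : 'I_m) (j : 'I_n) := fine (leb2 (lo_cell m n i j `&` S)).
have fin_cell (i : 'I_m) (j : 'I_n) : leb2 (lo_cell m n i j `&` S) \is a fin_num.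
  rewrite -[leb2 _]/(mu _) ge0_fin_numE ?measure_ge0 //.
  apply: (@le_lt_trans _ _ (mu S)); last by apply: le_lt_trans Ss _; rewrite ltry.
  apply: le_measure; rewrite ?inE; [|exact: mS|by move=> z []].
  by apply: measurableI => //; exact: measurable_lo_cell.
have c0 i j : 0 <= c i j by rewrite /c fine_ge0 // -[leb2 _]/(mu _) measure_ge0.
have sum_c : \sum_(i < m) \sum_(j < n) c i j <= s.
  rewrite pair_big /= -lee_fin; apply: le_trans Ss; apply: le_trans (sum_leb2_lo_cell m n mS).
  rewrite -sumEFin le_eqVlt; apply/orP; left; apply/eqP; apply: eq_bigr => p _.
  by rewrite /c fineK.
have le1 : \sum_i \sum_j F i j <= \sum_i \sum_j ((m * n)%:R * (M * c i j)
    + k^-1 * (F i j * graphon_mx W m n i j)).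
  apply: ler_sum => i _; apply: ler_sum => j _.
  have /andP[F0 FM'] := FM i j.
  apply: (@le_trans _ _ (F i j * ((m * n)%:R * c i j + k^-1 * graphon_mx W m n i j))).
    by rewrite -[leLHS]mulr1 ler_wpM2l //; apply: lo_cell_sublevel.
  rewrite mulrDr [X in _ + X]mulrCA lerD2r mulrCA ler_wpM2l ?ler0n // ler_wpM2r //.
apply: le_trans le1 _.
under eq_bigr do rewrite big_split /= -!mulr_sumr.
rewrite big_split /= -!mulr_sumr lerD2r ler_wpM2l ?ler0n //; exact: ler_wpM2l.
Qed.
End Cells.
End Plane.

(** * Mean square bound and upper limits *)

(** The permutations bringing [P] close to [W] are applied to [A - B] too: its sum of squares is
    unchanged and becomes aligned with the grid of [W]. The entries of [A] and [B] lie in [[-L, L]],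
    whence the bound [4 * L ^+ 2] on the squares. *)
Lemma sum_sqr_diff_le (R : realType) m n (A B P : 'M[R]_(m, n)) (W : R * R -> R)
    (q L t k s c e : R) :
  (0 < m)%N -> (0 < n)%N -> 0 < t -> 0 < L -> 0 < k ->
  nucnorm A <= q * Num.sqrt (m * n)%:R -> nucnorm B <= q * Num.sqrt (m * n)%:R ->
  maxnorm A <= L -> maxnorm B <= L -> binary_mx P -> graphon W ->
  (leb2 [set z | unit_sq z /\ (W z < k)%R] <= s%:E)%E ->
  cutdist P (graphon_mx W m n) < c ->
  \sum_i \sum_j (A i j - B i j) ^+ 2 * P i j <= (m * n)%:R * e ->
  \sum_i \sum_j (A i j - B i j) ^+ 2 <= (m * n)%:R * (4 * L ^+ 2 * s
    + k^-1 * (4 * e + 24 * q * t + 8 * ((q / t) ^+ 2 * (L ^+ 2 * (L / t) ^+ 2)) * c)).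
Proof.
move=> m0 n0 t0 L0 k0 nA nB mA mB Pb gW Ss /cutdist_lt[pi [tau cut]] De.
have N0 : 0 <= (m * n)%:R :> R by rewrite ler0n.
have P01 i j : 0 <= P i j <= 1 by case: (Pb i j) => ->; rewrite lexx ler01.
have H := weighted_diff_bound pi tau m0 n0 t0 L0 nA nB mA mB P01 (graphon_mx01 gW).
rewrite -(sum_permute (fun i j => (A i j - B i j) ^+ 2) pi tau).
have M0 : 0 <= 4 * L ^+ 2 by rewrite mulr_ge0 ?sqr_ge0.
have entry (C : 'M[R]_(m, n)) i j : maxnorm C <= L -> - L <= C i j <= L.
  by move=> mC; rewrite -ler_norml (le_trans (maxnorm_entry C i j)).
have FM i j : 0 <= (A (pi i) (tau j) - B (pi i) (tau j)) ^+ 2 <= 4 * L ^+ 2.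
  rewrite sqr_ge0 /=; have := entry A (pi i) (tau j) mA; have := entry B (pi i) (tau j) mB.
  move: (A _ _) (B _ _) => a b; nra.
apply: le_trans (mean_le_graphon_mean gW k0 M0 FM Ss) _.
rewrite mulrDr lerD2l mulrCA ler_pM2l ?invr_gt0 //.
apply: le_trans H _; rewrite -addrA mulrDr lerD //.
  by rewrite mulrCA ler_wpM2l.
rewrite mulrC ler_wpM2l // lerD2l ler_wpM2l ?(ltW cut) //.
by rewrite mulr_ge0 // mulr_ge0 ?sqr_ge0 // mulr_ge0 ?sqr_ge0.
Qed.

Lemma frobn_sqr (R : realType) m n (A : 'M[R]_(m, n)) : (0 < m)%N -> (0 < n)%N ->
  \sum_i \sum_j A i j ^+ 2 = (m * n)%:R * frobn A ^+ 2.
Proof.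
move=> m0 n0; rewrite /frobn sqr_sqrtr; last first.
  rewrite mulr_ge0 ?invr_ge0 ?ler0n // sumr_ge0 // => i _.
  by rewrite sumr_ge0 // => j _; rewrite sqr_ge0.
by rewrite mulrA mulfV ?mul1r // pnatr_eq0 muln_eq0 negb_or -!lt0n m0.
Qed.

(** The upper limit is an infimum, over neighbourhoods of infinity, of suprema; a strict bound on it
    is met by one neighbourhood. *)
Lemma limn_esup_lt_near (R : realType) (u : nat -> \bar R) (x : \bar R) :
  (limn_esup u < x)%E -> \forall k \near \oo, (u k < x)%E.
Proof.
move=> /ereal_inf_lt[_ [V Voo <-] Vx]; apply: filterS Voo => k Vk.
by apply: le_lt_trans Vx; apply: ereal_sup_ubound; exists k.
Qed.

Lemma limn_esup_le_near (R : realType) (u : nat -> \bar R) (x : \bar R) :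
  (\forall k \near \oo, (u k <= x)%E) -> (limn_esup u <= x)%E.
Proof.
move=> ux; apply: (@le_trans _ _ (ereal_sup (u @` [set k | (u k <= x)%E]))).
  by apply: ereal_inf_lbound; exists [set k | (u k <= x)%E].
by apply: ge_ereal_sup => _ [k /= uk <-].
Qed.

Unset Implicit Arguments.

Theorem theorem8p1 (R : realType) (m n : nat -> nat)
  (P : forall k, 'M[R]_(m k, n k)) (W : R * R -> R) :
  (forall N, exists K, forall k, (K <= k)%N -> (N <= m k)%N /\ (N <= n k)%N) ->
  (forall k, binary_mx (P k)) ->
  graphon W -> nonzero_ae W ->
  (fun k => cutdist (P k) (graphon_mx W (m k) (n k))) @ \oo --> (0 : R) ->
  forall q L eps : R, 0 < eps ->
  exists delta : R, 0 < delta /\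
  forall (A B : forall k, 'M[R]_(m k, n k)),
    (forall k, nucnorm (A k) <= q * Num.sqrt ((m k * n k)%:R) /\
               nucnorm (B k) <= q * Num.sqrt ((m k * n k)%:R)) ->
    (forall k, maxnorm (A k) <= L /\ maxnorm (B k) <= L) ->
    (limn_esup (fun k => (frobn (hadamard (A k - B k) (P k)))%:E) <= delta%:E)%E ->
    (limn_esup (fun k => (frobn (A k - B k))%:E) <= eps%:E)%E.
Proof.
move=> mnoo Pb gW W0 cutP q0 L0 eps eps0.
(* Enlarging the given bounds makes them positive, so that they may be divided by. *)
pose L := `|L0| + 1; pose q := `|q0| + 1.
have Lp : 0 < L by rewrite ltr_wpDl.
have qp : 0 < q by rewrite ltr_wpDl.
pose E := eps ^+ 2; have E0 : 0 < E by rewrite exprn_gt0.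
(* This measure makes the sublevel term [4 * L ^+ 2 * s] equal to [E / 2]. *)
have [|k k0 Sk] := @small_sublevel R W (E / (8 * L ^+ 2)) gW W0.
  by rewrite divr_gt0 // mulr_gt0 // exprn_gt0.
(* [t], [c] and [delta] are chosen so that the truncation, cut norm and masked terms each amount to
   [E / 8] after division by [k]. *)
pose t := k * E / (192 * q).
have t0 : 0 < t by rewrite divr_gt0 // mulr_gt0.
pose C := (q / t) ^+ 2 * (L ^+ 2 * (L / t) ^+ 2).
have C0 : 0 < C.
  by apply: mulr_gt0; [|apply: mulr_gt0]; rewrite exprn_gt0 // divr_gt0.
pose c := k * E / (64 * C).
have c0 : 0 < c by rewrite divr_gt0 // mulr_gt0.
pose delta := Num.sqrt (k * E / 128).
have kE0 : 0 < k * E / 128 by rewrite divr_gt0 // mulr_gt0.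
have d0 : 0 < delta by rewrite sqrtr_gt0.
exists delta; split=> // A B nAB mAB fAB.
apply: limn_esup_le_near.
have near_cut : \forall i \near \oo, cutdist (P i) (graphon_mx W (m i) (n i)) < c.
  move/cvgrPdist_lt: cutP => /(_ c c0); apply: filterS => i.
  by rewrite sub0r normrN; apply: le_lt_trans (ler_norm _).
(* An upper limit at most [delta] yields eventual bounds only by larger numbers; the choice
   [2 * delta] accounts for the factor 4 in [De]. *)
have near_frob : \forall i \near \oo,
    ((frobn (hadamard (A i - B i) (P i)))%:E < (2 * delta)%:E)%E.
  apply: limn_esup_lt_near; apply: le_lt_trans fAB _.
  by rewrite lte_fin mulr_natl mulr2n ltrDl.
have near_pos : \forall i \near \oo, (0 < m i)%N /\ (0 < n i)%N.
  by have [K HK] := mnoo 1%N; exists K.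
apply: filterS (filterI near_pos (filterI near_cut near_frob)) => i [[mi ni] [cuti]].
rewrite !lte_fin lee_fin => frobi.
have N0 : 0 < (m i * n i)%:R :> R by rewrite ltr0n muln_gt0 mi.
have qle : q0 <= q by rewrite (le_trans (ler_norm _)) // lerDl.
have Lle : L0 <= L by rewrite (le_trans (ler_norm _)) // lerDl.
have [nA nB] : nucnorm (A i) <= q * Num.sqrt (m i * n i)%:R /\
    nucnorm (B i) <= q * Num.sqrt (m i * n i)%:R.
  by have [h1 h2] := nAB i; split; [apply: le_trans h1 _|apply: le_trans h2 _];
    rewrite ler_wpM2r ?sqrtr_ge0.
have [mA mB] : maxnorm (A i) <= L /\ maxnorm (B i) <= L.
  by have [h1 h2] := mAB i; split; [apply: le_trans h1 _|apply: le_trans h2 _].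
(* A binary entry equals its square, so weighting the squares by [P] agrees with squaring the masked
   difference. *)
have De : \sum_a \sum_b (A i a b - B i a b) ^+ 2 * P i a b
    <= (m i * n i)%:R * (4 * (k * E / 128)).
  have -> : \sum_a \sum_b (A i a b - B i a b) ^+ 2 * P i a b =
      \sum_a \sum_b hadamard (A i - B i) (P i) a b ^+ 2.
    apply: eq_bigr => a _; apply: eq_bigr => b _; rewrite !mxE exprMn.
    by case: (Pb i a b) => ->; rewrite ?expr0n ?expr1n.
  rewrite frobn_sqr // ler_pM2l // -(sqr_sqrtr (ltW kE0)) -/delta.
  have -> : 4 * delta ^+ 2 = (2 * delta) ^+ 2 by ring.
  by rewrite lerXn2r ?nnegrE ?sqrtr_ge0 ?mulr_ge0 ?(ltW d0) ?(ltW frobi).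
have := sum_sqr_diff_le mi ni t0 Lp k0 nA nB mA mB (Pb i) gW Sk cuti De.
have -> : \sum_a \sum_b (A i a b - B i a b) ^+ 2 = \sum_a \sum_b (A i - B i) a b ^+ 2.
  by apply: eq_bigr => a _; apply: eq_bigr => b _; rewrite !mxE.
rewrite frobn_sqr // ler_pM2l // -/C => Hle.
rewrite -(ler_pXn2r (n := 2)) ?nnegrE ?sqrtr_ge0 ?(ltW eps0) // -/E.
apply: le_trans Hle _.
(* The contributions are [1/2 + 1/8 + 1/8 + 1/8] of [E]. *)
have -> : 4 * L ^+ 2 * (E / (8 * L ^+ 2)) + k^-1 * (4 * (4 * (k * E / 128)) + 24 * q * t
    + 8 * C * c) = 7 / 8 * E.
  by rewrite /c /t; field; rewrite !gt_eqF.
by lra.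
Qed.
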